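(* Let $L\subseteq\mathbb{Z}^\omega$ be a Lusin set such that $L+L=\mathbb{Z}^\omega$. Then $L$ does not have property ${\sf U}_{fin}(\Gamma,\Omega)$.
   Context: $\mathbb{Z}^\omega$ is the countable product of the integers with the product topology and pointwise addition, and $L+L=\{x+y:x,y\in L\}$. A Lusin set is an uncountable set whose intersection with every meager (first category) set is countable. ''Cover'' means countable open cover. A cover of $X$ is an $\omega$-cover if $X$ is not a member and every finite subset of $X$ is contained in some member; a $\gamma$-cover if it is infinite and each point of $X$ fails to belong to only finitely many members. $X$ has ${\sf U}_{fin}(\Gamma,\Omega)$ if for every sequence $(\mathcal{U}_n)$ of $\gamma$-covers of $X$ one can choose finite $\mathcal{V}_n\subseteq\mathcal{U}_n$ such that either $\{\bigcup\mathcal{V}_n:n\in\omega\}$ is an $\omega$-cover of $X$ or $\bigcup\mathcal{V}_n=X$ for some $n$. *)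

(* Defs.v *)
From HB Require Import structures.
From mathcomp Require Import all_boot all_order all_algebra.
From mathcomp Require Import all_classical topology.

Set Implicit Arguments.
Unset Strict Implicit.
Unset Printing Implicit Defensive.

Import GRing.Theory.
Local Open Scope classical_set_scope.
Local Open Scope ring_scope.

(* [int] has no canonical topology in the library; the factors of the product
   carry the discrete topology. *)
Definition Zomega : Type := prod_topology (fun _ : nat => discrete_topology int).

HB.instance Definition _ :=
  Topological.copy Zomega (prod_topology (fun _ : nat => discrete_topology int)).
HB.instance Definition _ := GRing.Zmodule.copy Zomega (nat -> int).

Lemma ZomegaD (x y : Zomega) n : (x + y) n = (x n : int) + (y n : int).
Proof. by []. Qed.

Section CategoryNotions.
Context {T : topologicalType}.

Definition nowhere_dense (A : set T) := (closure A)° = set0.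

Definition meager (A : set T) :=
  exists2 F : nat -> set T,
    (forall n, nowhere_dense (F n)) & A = \bigcup_n F n.

Definition lusin (L : set T) :=
  ~ countable L /\ forall M : set T, meager M -> countable (L `&` M).

End CategoryNotions.

(* Covers are families of open subsets of a space [X]. For a subset [L] of a
   space, these notions are applied to the type [set_type L], which carries the
   subspace topology, so the members are relatively open subsets of [L]. *)
Section Covers.
Context {X : topologicalType}.
Implicit Types U : set (set X).

Definition countable_open_cover U :=
  [/\ countable U, (forall A, U A -> open A) & \bigcup_(A in U) A = setT].

Definition omega_cover U :=
  [/\ countable_open_cover U, ~ U setT &
      forall F : set X, finite_set F -> exists2 A, U A & F `<=` A].

Definition gamma_cover U :=
  [/\ countable_open_cover U, infinite_set U &
      forall x : X, finite_set [set A | U A /\ ~ A x]].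

End Covers.

Definition Ufin_Gamma_Omega (X : topologicalType) :=
  forall U : nat -> set (set X), (forall n, gamma_cover (U n)) ->
  exists V : nat -> set (set X),
    (forall n, finite_set (V n) /\ V n `<=` U n) /\
    (omega_cover [set \bigcup_(A in V n) A | n in [set: nat]] \/
     exists n, \bigcup_(A in V n) A = setT).

(* Main.v *)
(** For each coordinate [n] the sets [{x | |x n| <= k}], [k] in [nat], form a
    gamma-cover of [L], and finitely many of them are contained in a single one.
    A selection from these covers is thus bounded by some [g : nat -> nat]; the
    two points of [L] whose sum is [n |-> 2 * g n + 1] are together in no
    selected set. *)
Require Import Defs.
From mathcomp Require Import all_boot all_order all_algebra.
From mathcomp Require Import all_classical topology.
From mathcomp Require Import zify.

Import GRing.Theory.
Local Open Scope classical_set_scope.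
Local Open Scope ring_scope.

Definition slab (L : set Zomega) (n k : nat) : set (set_type L) :=
  [set x | (`|(\val x : Zomega) n : int| <= k)%N].

Lemma slab_open (L : set Zomega) n k : open (slab L n k).
Proof.
have coord_cont : continuous
    ((fun x : Zomega => x n : discrete_topology int) \o (\val : set_type L -> Zomega)).
  move=> x; apply: continuous_comp; first exact: initial_continuous.
  exact: (@proj_continuous nat (fun=> discrete_topology int) n).
pose D : set (discrete_topology int) := [set z | (`|(z : int)| <= k)%N].
by move/continuousP: coord_cont => /(_ D); apply; exact: discrete_open.
Qed.

(** As [f] is increasing, its value at the largest index used by [V] contains every member of
    [V]. *)
Lemma finite_sub_range_bounded (T : Type) (f : nat -> set T) (V : set (set T)) :
  {homo f : m n / (m <= n)%N >-> m `<=` n} ->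
  finite_set V -> V `<=` range f -> exists k, \bigcup_(A in V) A `<=` f k.
Proof.
move=> fmono /finite_seqP[s ->] sf.
have /choice[idx fidx] (A : set T) : exists k, A \in s -> f k = A.
  (* The index 0 for sets outside [s] is a dummy value that makes [idx] total. *)
  case: (boolP (A \in s)) => [/sf[k _ fk]|_]; [by exists k | by exists 0%N].
exists (\max_(A <- s) idx A)%N => x [A /= As Ax].
by apply: (fmono (idx A)); [exact: leq_bigmax_seq | rewrite fidx].
Qed.

Lemma slab_mono L n : {homo slab L n : k m / (k <= m)%N >-> k `<=` m}.
Proof. by move=> k m km x /leq_trans; exact. Qed.

(** Triangle inequality: two integers of absolute value at most [g n] cannot add up to
    [2 * g n + 1]. One pair of points works for all [n] at once. *)
Lemma sumset_escape_slabs (L : set Zomega) (g : nat -> nat) :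
  [set x + y | x in L & y in L] = [set: Zomega] ->
  exists x y : set_type L, forall n, ~ (slab L n (g n) x /\ slab L n (g n) y).
Proof.
move=> LL; pose h : Zomega := fun n => (2 * g n + 1)%N%:Z.
have [x Lx [y Ly xyh]] : [set x + y | x in L & y in L] h by rewrite LL.
exists (SigSub (mem_set Lx)), (SigSub (mem_set Ly)) => n.
rewrite /slab /= => -[].
by have := congr1 (fun z : Zomega => z n : int) xyh; rewrite ZomegaD /h; lia.
Qed.

(** The case of constant [g]. It gives the infinitude of the covers and rules out that a finite
    selection already covers [L]. *)
Lemma slab_neqT (L : set Zomega) n k :
  [set x + y | x in L & y in L] = [set: Zomega] -> ~ [set: set_type L] `<=` slab L n k.
Proof.
move=> LL sT; have [x [y xy]] := sumset_escape_slabs L (fun=> k) LL.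
by apply: (xy n); split; exact: sT.
Qed.

Lemma slab_gamma_cover (L : set Zomega) n :
  [set x + y | x in L & y in L] = [set: Zomega] -> gamma_cover (range (slab L n)).
Proof.
move=> LL.
have cover : \bigcup_(A in range (slab L n)) A = setT.
  apply/seteqP; split=> // x _.
  pose k := `|(\val x : Zomega) n : int|%N.
  by exists (slab L n k); [exists k | exact: leqnn].
split.
- split=> //; first exact: card_le_trans (card_image_le _ _) (countableP _).
  by move=> _ [k _ <-]; exact: slab_open.
(* A finite range would be bounded by one of its own slabs, which would then be all of [L]. *)
- move=> /(finite_sub_range_bounded _ _ _ (slab_mono L n)) /(_ (fun _ => id))[k].
  by rewrite cover; exact: slab_neqT.
(* A slab that misses [x] has its bound [k] below the absolute value of [x n]. *)
- move=> x; apply: (@sub_finite_set _ _ (slab L n @` `I_`|(\val x : Zomega) n : int|%N)).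
    by move=> _ [[k _ <-] xk]; exists k => //=; rewrite ltnNge; apply/negP.
  by apply: finite_image; exact: finite_II.
Qed.

Theorem mainTheorem16 (L : set Zomega) :
  lusin L ->
  [set x + y | x in L & y in L] = [set: Zomega] ->
  ~ Ufin_Gamma_Omega (set_type L).
Proof.
move=> _ LL /(_ (fun n => range (slab L n)) (fun n => slab_gamma_cover L n LL)).
move=> [V [Vfin Vcover]].
have /choice[g Vg] n : exists k, \bigcup_(A in V n) A `<=` slab L n k.
  by have [fin sub] := Vfin n; exact: finite_sub_range_bounded _ _ _ (slab_mono L n) fin sub.
case: Vcover => [[_ _ Vomega]|[n Vn]]; last first.
  by apply: (slab_neqT L n (g n)) => //; rewrite -Vn.
have [x [y xy]] := sumset_escape_slabs L g LL.
(* An omega-cover must catch the pair [x], [y] in a single member, hence in the slab of bound [g n]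
   for some [n]. *)
have [_ [n _ <-] xyV] := Vomega [set x; y] (finite_set2 x y).
by apply: (xy n); split; apply: Vg; apply: xyV; [left | right].
Qed.
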